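(* Let $\gamma_0 > 0$ and $0 \le r < 1$, and put $\gamma_1 = \tfrac12(1+\sqrt{3})$, $\gamma_2 = \gamma_0\gamma_1$ and $\gamma_3 = 2^{3/2}e^{1/2}/\gamma_1$. For each integer $d \ge 2$ let $\Sigma = \Sigma_d$ be a real symmetric $d\times d$ matrix such that $\|\Sigma\| \le \gamma_0 d^{r/2}$. Then for all integers $m \ge 1$ and all integers $d \ge 2$ with $d \ge (2\gamma_2^2)^{1/(1-r)}$, $$|R_m(\Sigma)| \le \frac{\gamma_3\,\gamma_2^m}{[(m+1)!]^{1/2}}\, d^{-m(1-r)/2},$$ where $$R_m(\Sigma) = \sum_{k=m}^\infty \frac{(1/2)_k}{(d/2)_k}\,\frac{C_{(k)}(\Sigma)}{k!}.$$ In particular, for each fixed $m\ge 1$, $R_m(\Sigma) = O\big(d^{-m(1-r)/2}\big)$ as $d \to \infty$.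
   Context: $\|\Sigma\| = [\mathrm{tr}(\Sigma^2)]^{1/2}$ is the Frobenius norm. For $a\in\mathbb{R}$, $(a)_k = a(a+1)\cdots(a+k-1)$ is the rising factorial, with $(a)_0=1$. The zonal polynomial of the one-part partition $(k)$, evaluated at a real symmetric $d \times d$ matrix $\Sigma$, is $$C_{(k)}(\Sigma) = \frac{k!}{(1/2)_k}\sum_{i_1+2i_2+\cdots+ki_k=k}\ \prod_{j=1}^k \frac{[\mathrm{tr}(\Sigma^j)]^{i_j}}{i_j!\,(2j)^{i_j}},$$ where the sum is over all nonnegative integers $i_1,\ldots,i_k$ with $i_1+2i_2+\cdots+ki_k=k$ (so $C_{(0)}(\Sigma)=1$). Background (known): the Bingham normalizing constant $\Psi_d(\Sigma)=\int_{\mathcal{S}^{d-1}}\exp(x'\Sigma x)\,\mathrm{d}x$, where $\mathrm{d}x$ is the normalized (total mass $1$) surface measure on the unit sphere $\mathcal{S}^{d-1}\subset\mathbb{R}^d$, equals the absolutely convergent series $\sum_{k=0}^\infty \frac{(1/2)_k}{(d/2)_k}\frac{C_{(k)}(\Sigma)}{k!}$, so $R_m(\Sigma)$ is the remainder after the first $m$ terms. Notation: $g_1(d)=O(g_2(d))$ as $d\to\infty$ (with $g_2\ge 0$) means there is a constant $\gamma>0$ with $|g_1(d)|\le\gamma g_2(d)$ for all sufficiently large $d$. *)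

(* Defs.v *)
From HB Require Import structures.
From mathcomp Require Import all_boot all_order all_algebra.
From mathcomp Require Import all_classical all_reals all_analysis.

Set Implicit Arguments.
Unset Strict Implicit.
Unset Printing Implicit Defensive.

Import Order.TTheory GRing.Theory Num.Theory.
Import numFieldNormedType.Exports.

Local Open Scope ring_scope.

Definition frobenius_norm (R : realType) (d : nat) (S : 'M[R]_d) : R :=
  Num.sqrt (\tr (S ^+ 2)).

Definition rising_factorial (R : realType) (a : R) (k : nat) : R :=
  \prod_(i < k) (a + i%:R).

(* The indices 1, ..., k are represented by j : 'I_k standing for j.+1. The
   exponents may be taken in 'I_k.+1, since i_1 + 2 i_2 + ... + k i_k = k
   forces every i_j <= k. *)
Definition zonal_polynomial (R : realType) (d k : nat) (S : 'M[R]_d) : R :=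
  k`!%:R / rising_factorial (1 / 2) k *
  \sum_(i : {ffun 'I_k -> 'I_k.+1} | (\sum_(j < k) j.+1 * i j == k)%N)
    \prod_(j < k)
      (\tr (S ^+ j.+1) ^+ i j / ((i j)`!%:R * (2 * j.+1)%:R ^+ i j)).

Definition bingham_term (R : realType) (d : nat) (S : 'M[R]_d) (k : nat) : R :=
  rising_factorial (1 / 2) k / rising_factorial (d%:R / 2) k
  * (zonal_polynomial k S / k`!%:R).

(* limn returns a default value on divergent sequences; here the partial sums
   converge absolutely for every real symmetric S of size d >= 1. *)
Definition bingham_remainder (R : realType) (m d : nat) (S : 'M[R]_d) : R :=
  limn (fun n => \sum_(m <= k < n) bingham_term S k).

(* Main.v *)
Require Import Defs.
From mathcomp Require Import all_boot all_order all_algebra.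
From mathcomp Require Import all_classical all_reals all_analysis.
From mathcomp Require Import ring lra zify.

(** Let p_k = (1/2)_k C_(k)(S) / k!, so that the k-th term of the series is
    p_k / (d/2)_k. Writing x_j for the trace of S^(j+1), p_k is the coefficient
    of t^k in the exponential of the sum over j of x_j t^(j+1) / (2 (j+1)).

    All monomials of p_k have positive coefficients, so p_k is bounded by its
    value at upper bounds of the |x_j|. With s the Frobenius norm of S, the
    Cauchy-Schwarz inequality gives |tr S| <= sqrt d * s, and |tr S^j| <= s^j
    for j >= 2; by homogeneity |p_k| <= s^k c_k, where c_k is the value of p_k
    at the weights w_0 = sqrt d and w_1 = w_2 = ... = 1.

    Differentiating the generating function gives Newton's recurrence
    k c_k = (1/2) sum_(j < k) w_j c_(k-1-j). The weights do not increase with j,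
    so comparing two consecutive instances gives
    (k+1) c_(k+1) <= (k + (sqrt d)/2) c_k. The quotient of the (k+1)-st by the
    k-th of the numbers c_k (sqrt d)^k / (d/2)_k is therefore at most
    (2 k u + u^2) / ((k + 1) (u^2 + 2 k)) with u = sqrt d. For k = 1 the largest
    value of (2 k u + u^2) / (u^2 + 2 k) over u is gamma1, the positive
    root of g^2 = g + 1/2, and for every k >= 1 it is at most gamma1 * sqrt k
    (quotient_step_le). As sqrt k / (k + 1) <= 1 / sqrt (k + 2), induction on k
    gives (norm_bingham_term_le), for k >= 1,

      |p_k| / (d/2)_k
        <= (sqrt 2 / gamma1) (gamma1 s / sqrt d)^k / sqrt ((k+1)!).

    Under the hypotheses gamma1 s / sqrt d <= q, where
    q = gamma2 d^(-(1-r)/2), and the lower bound on d says that q^2 <= 1/2. Then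
    consecutive bounds have quotient q / sqrt (k+2) <= 1/2, so that the tail
    from m is at most twice its first bound. The resulting constant
    2 sqrt 2 / gamma1 is smaller than gamma3 by the factor e^(1/2). *)

Import Order.TTheory GRing.Theory Num.Theory.
Import numFieldNormedType.Exports.

Set Implicit Arguments.
Unset Strict Implicit.
Unset Printing Implicit Defensive.

Local Open Scope classical_set_scope.
Local Open Scope ring_scope.

(** * Traces of powers and the Frobenius norm *)

(** Lagrange's identity: the difference of the two sides is half of
    the double sum of the squares of a_i b_j - a_j b_i. *)
Lemma sqr_sum_mul_le (R : realDomainType) (I : finType) (a b : I -> R) :
  (\sum_i a i * b i) ^+ 2 <= (\sum_i a i ^+ 2) * (\sum_i b i ^+ 2).
Proof.
have: 0 <= \sum_i \sum_j (a i * b j - a j * b i) ^+ 2.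
  by do 2![apply: sumr_ge0 => ? _]; exact: sqr_ge0.
have -> : \sum_i \sum_j (a i * b j - a j * b i) ^+ 2 =
    2 * ((\sum_i a i ^+ 2) * (\sum_i b i ^+ 2) - (\sum_i a i * b i) ^+ 2).
  under eq_bigr => i _.
    under eq_bigr => j _.
      rewrite (_ : _ ^+ 2 = a i ^+ 2 * b j ^+ 2 + b i ^+ 2 * a j ^+ 2
        - 2 * ((a i * b i) * (a j * b j))); last by ring.
      over.
    rewrite !big_split /= sumrN -!mulr_sumr.
    over.
  rewrite !big_split /= sumrN -mulr_sumr -!mulr_suml.
  by ring.
by rewrite pmulr_rge0 ?subr_ge0.
Qed.

Definition sqnorm (R : realDomainType) m n (A : 'M[R]_(m, n)) : R :=
  \sum_i \sum_j A i j ^+ 2.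

Lemma sqnorm_ge0 (R : realDomainType) m n (A : 'M[R]_(m, n)) : 0 <= sqnorm A.
Proof. by do 2![apply: sumr_ge0 => ? _]; exact: sqr_ge0. Qed.

Lemma sqnorm_mul (R : realDomainType) m n p
    (A : 'M[R]_(m, n)) (B : 'M[R]_(n, p)) :
  sqnorm (A *m B) <= sqnorm A * sqnorm B.
Proof.
rewrite /sqnorm [X in _ * X]exchange_big /= mulr_suml; apply: ler_sum => i _.
rewrite mulr_sumr; apply: ler_sum => j _.
by rewrite mxE; exact: sqr_sum_mul_le.
Qed.

Lemma sqr_mxtrace_mul_le (R : realDomainType) m n
    (A : 'M[R]_(m, n)) (B : 'M[R]_(n, m)) :
  (\tr (A *m B)) ^+ 2 <= sqnorm A * sqnorm B.
Proof.
rewrite /mxtrace; under eq_bigr do rewrite mxE.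
rewrite /sqnorm [X in _ * X]exchange_big /= !pair_big /=.
exact: sqr_sum_mul_le.
Qed.

Lemma sqnorm1 (R : realDomainType) d : sqnorm (1%:M : 'M[R]_d) = d%:R.
Proof.
rewrite /sqnorm (eq_bigr (fun=> 1)) ?sumr_const ?card_ord // => i _.
rewrite (bigD1 i) //= big1 ?mxE ?eqxx ?expr1n ?addr0 // => j ji.
by rewrite mxE eq_sym (negPf ji) expr0n.
Qed.

Lemma sqnorm_exp (R : realDomainType) d (S : 'M[R]_d) k :
  sqnorm (S ^+ k.+1) <= sqnorm S ^+ k.+1.
Proof.
elim: k => [|k IH]; first by rewrite !expr1.
rewrite exprS [in leRHS]exprS; apply: le_trans (sqnorm_mul _ _) _.
by rewrite ler_wpM2l ?sqnorm_ge0.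
Qed.

Lemma frobenius_normE (R : realType) d (S : 'M[R]_d) :
  S^T = S -> frobenius_norm S = Num.sqrt (sqnorm S).
Proof.
move=> ST; rewrite /frobenius_norm expr2; congr (Num.sqrt _).
rewrite /mxtrace; apply: eq_bigr => i _; rewrite mxE; apply: eq_bigr => j _.
by rewrite -[in S j i]ST mxE expr2.
Qed.

Lemma norm_le_sqrt (R : rcfType) (x y : R) : x ^+ 2 <= y -> `|x| <= Num.sqrt y.
Proof. by move=> h; rewrite -sqrtr_sqr ler_wsqrtr. Qed.

Lemma norm_mxtrace_le (R : realType) d (S : 'M[R]_d) : S^T = S ->
  `|\tr S| <= Num.sqrt d%:R * frobenius_norm S.
Proof.
move=> ST; rewrite frobenius_normE // -sqrtrM ?ler0n //; apply: norm_le_sqrt.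
by rewrite -[in leLHS](mul1mx S) -(sqnorm1 R); exact: sqr_mxtrace_mul_le.
Qed.

Lemma norm_mxtrace_exp_le (R : realType) d (S : 'M[R]_d) k : S^T = S ->
  `|\tr (S ^+ k.+2)| <= frobenius_norm S ^+ k.+2.
Proof.
move=> ST; rewrite frobenius_normE //.
have -> : Num.sqrt (sqnorm S) ^+ k.+2 = Num.sqrt (sqnorm S ^+ k.+2).
  rewrite -[LHS]ger0_norm ?exprn_ge0 ?sqrtr_ge0 //.
  by rewrite -sqrtr_sqr exprAC sqr_sqrtr ?sqnorm_ge0.
apply: norm_le_sqrt; rewrite exprS; apply: le_trans (sqr_mxtrace_mul_le _ _) _.
by rewrite exprS ler_wpM2l ?sqnorm_ge0 ?sqnorm_exp.
Qed.

(** * The power-sum polynomial and Newton's recurrence *)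

(** This is (1/2)_k C_(k) / k! as a polynomial in the power sums x_0, x_1, ...;
    equivalently, the cycle index of the symmetric group on k letters, evaluated
    at the numbers x_j / 2. *)
Definition half_cycle_index (R : fieldType) (x : nat -> R) (k : nat) : R :=
  \sum_(i : {ffun 'I_k -> 'I_k.+1} | (\sum_(j < k) j.+1 * i j == k)%N)
    \prod_(j < k) (x j ^+ i j / ((i j)`!%:R * (2 * j.+1)%:R ^+ i j)).

(** The exponential of x_j t^(j+1) / (2 (j+1)), cut after N+1 terms so as to be a
    polynomial. *)
Definition truncated_exp (R : fieldType) (x : nat -> R) (N j : nat) : {poly R} :=
  \sum_(i < N.+1)
    (x j ^+ i / (i`!%:R * (2 * j.+1)%:R ^+ i)) *: 'X^(j.+1 * i).

Definition truncated_series (R : fieldType) (x : nat -> R) (N : nat) : {poly R} :=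
  \prod_(j < N) truncated_exp x N j.

(** Expanding the product, a choice of one term per factor is a finite function
    i, and it contributes to the degree sum_j (j+1) i_j. *)
Lemma half_cycle_indexE (R : fieldType) (x : nat -> R) k :
  half_cycle_index x k = (truncated_series x k)`_k.
Proof.
rewrite /truncated_series bigA_distr_bigA coef_sum /half_cycle_index big_mkcond /=.
apply: eq_bigr => i _; rewrite scaler_prod coefZ.
rewrite prodrXr coefXn eq_sym.
by case: eqP => _; rewrite ?mulr1 ?mulr0.
Qed.

(** The exponential satisfies E' = (x_j t^j / 2) E; the truncation breaks this only
    through the top term, in degrees at least N. *)
Lemma deriv_truncated_exp (R : numFieldType) (x : nat -> R) N j :
  exists e, (truncated_exp x N j)^`() =
    ((x j / 2) *: 'X^j) * truncated_exp x N j + e * 'X^N.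
Proof.
pose c i := x j ^+ i / (i`!%:R * (2 * j.+1)%:R ^+ i).
exists (- (x j / 2 * c N) *: 'X^(j + j * N)).
rewrite {2}(_ : truncated_exp x N j =
  \sum_(i < N) c i *: 'X^(j.+1 * i) + c N *: 'X^(j.+1 * N)); last first.
  by rewrite /truncated_exp big_ord_recr.
have -> : (- (x j / 2 * c N) *: 'X^(j + j * N)) * 'X^N =
    - ((x j / 2) *: 'X^j * (c N *: 'X^(j.+1 * N))) :> {poly R}.
  rewrite -!mul_polyC polyCN [((_ * _)%R)%:P]polyCM.
  rewrite (_ : (j.+1 * N = j * N + N)%N); last by lia.
  by rewrite !exprD; ring.
rewrite mulrDr addrK.
rewrite raddf_sum /= big_ord_recl /= muln0 expr0 derivZ.
rewrite derivC scaler0 add0r mulr_sumr; apply: eq_bigr => i _.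
rewrite [RHS](_ : _ = (x j / 2 * c i) *: 'X^(j + j.+1 * i)); last first.
  by rewrite -!mul_polyC [((_ * c i)%R)%:P]polyCM exprD; ring.
rewrite derivZ derivXn -scalerMnr scalerMnl -mulr_natr.
rewrite /bump /= add1n /c.
congr (_ *: 'X^ _); last by lia.
rewrite factS !exprS !natrM.
have p0 : (2 * j.+1%:R) ^+ i != 0 :> R by rewrite expf_neq0 // mulf_neq0 ?pnatr_eq0.
move: p0; set p := (2 * j.+1%:R) ^+ i; move: p => p p0.
have : i`!%:R != 0 :> R by rewrite pnatr_eq0 -lt0n fact_gt0.
have : j.+1%:R != 0 :> R by rewrite pnatr_eq0.
have : i.+1%:R != 0 :> R by rewrite pnatr_eq0.
move: (_ ^+ i) (_`!%:R) i.+1%:R j.+1%:R => y f a b a0 b0 f0.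
by field; rewrite a0 b0 f0 p0.
Qed.

(** Logarithmic differentiation of a product, modulo q. *)
Lemma deriv_prod_mod (R : comNzRingType) (E g : nat -> {poly R}) (q : {poly R}) n :
  (forall j, exists e, (E j)^`() = g j * E j + e * q) ->
  exists e, (\prod_(j < n) E j)^`() =
    (\sum_(j < n) g j) * \prod_(j < n) E j + e * q.
Proof.
move=> hE; elim: n => [|n [e IH]].
  by exists 0; rewrite !big_ord0 derivC !mul0r addr0.
have [f hf] := hE n; exists (e * E n + f * \prod_(j < n) E j).
by rewrite !big_ord_recr /= derivM IH hf; ring.
Qed.

(** Newton's recurrence, read off from the coefficient of t^k in the derivative.
    The truncation at N is harmless exactly for k < N, which is all that is needed
    to reach the coefficient of index N. *)
Lemma newton_truncated_series (R : numFieldType) (x : nat -> R) N k : (k < N)%N ->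
  k.+1%:R * (truncated_series x N)`_k.+1 =
    2^-1 * \sum_(j < k.+1) x j * (truncated_series x N)`_(k - j).
Proof.
move=> kN; pose c := nth 0 (truncated_series x N).
have [e he] := deriv_prod_mod N (deriv_truncated_exp x N).
have := congr1 (fun p : {poly R} => p`_k) he.
rewrite coef_deriv coefD coefMXn kN addr0 mulr_natl => ->.
rewrite mulr_suml coef_sum mulr_sumr.
rewrite (big_ord_widen_cond N xpredT (fun j => 2^-1 * (x j * c (k - j)%N))) //.
rewrite [RHS]big_mkcond /=; apply: eq_bigr => j _.
rewrite -scalerAl coefZ coefXnM ltnS leqNgt.
by rewrite ltnS; case: leqP => _; rewrite ?mulr0 // mulrA [2^-1 * _]mulrC.
Qed.

Lemma coef0_truncated_series (R : numFieldType) (x : nat -> R) N :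
  (truncated_series x N)`_0 = 1.
Proof.
rewrite /truncated_series coef0_prod big1 // => j _; rewrite coef_sum big_ord_recl /= big1.
  by rewrite muln0 !expr0 fact0 mulr1 coefZ coef1 divr1 mulr1 addr0.
by move=> i _; rewrite coefZ coefXn /bump /= mulr0.
Qed.

(** The coefficients of the polynomial are positive. *)
Lemma half_cycle_index_norm_le (R : numFieldType) (x y : nat -> R) k :
  (forall j, `|x j| <= y j) -> `|half_cycle_index x k| <= half_cycle_index y k.
Proof.
move=> xy; apply: le_trans (ler_norm_sum _ _ _) _; apply: ler_sum => i _.
rewrite normr_prod; apply: ler_prod => j _; rewrite normr_ge0 /=.
rewrite normrM normrX [X in _ * X <= _]ger0_norm ?invr_ge0 ?mulr_ge0 ?exprn_ge0 //.
rewrite ler_wpM2r ?invr_ge0 ?mulr_ge0 ?exprn_ge0 //.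
by apply: lerXn2r; rewrite ?nnegrE // (le_trans _ (xy _)).
Qed.

Lemma half_cycle_index_homog (R : fieldType) (s : R) (x : nat -> R) k :
  half_cycle_index (fun j => s ^+ j.+1 * x j) k = s ^+ k * half_cycle_index x k.
Proof.
rewrite /half_cycle_index mulr_sumr; apply: eq_bigr => i /eqP ik.
rewrite -[in s ^+ k]ik expr_sum -big_split /=; apply: eq_bigr => j _.
by rewrite exprMn -exprM mulrA.
Qed.

Lemma coef_truncated_series_ge0 (R : numFieldType) (x : nat -> R) N k :
  (forall j, 0 <= x j) -> 0 <= (truncated_series x N)`_k.
Proof.
move=> x0; move: k; apply: (big_ind (fun p : {poly R} => forall k, 0 <= p`_k)).
- by move=> k; rewrite coef1 ler0n.
- by move=> p q p0 q0 k; rewrite coefM sumr_ge0 // => j _; rewrite mulr_ge0.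
move=> j _ k; rewrite coef_sum sumr_ge0 // => i _; rewrite coefZ coefXn.
by rewrite !mulr_ge0 ?invr_ge0 ?mulr_ge0 ?exprn_ge0.
Qed.

(** Newton's recurrences for the indices k+2 and k+1, the first with its j = 0
    term split off, have the same remaining coefficients with weights x_(j+1)
    and x_j; so (k+2) c_(k+2) - (x_0 / 2) c_(k+1) <= (k+1) c_(k+1). *)
Lemma coef_truncated_series_ratio (R : numFieldType) (x : nat -> R) N k :
  (forall j, 0 <= x j.+1 <= x j) -> (k.+1 < N)%N ->
  k.+2%:R * (truncated_series x N)`_k.+2 <=
    (k.+1%:R + x 0%N / 2) * (truncated_series x N)`_k.+1.
Proof.
move=> xdec kN.
have x0 j : 0 <= x j.
  by case: j => [|j]; [have /andP[/le_trans h /h] := xdec 0%N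
                      | have /andP[] := xdec j].
rewrite (newton_truncated_series x kN) big_ord_recl subn0 /=.
rewrite mulrDr mulrDl [leLHS]addrC [2^-1 * (x 0 * _)]mulrCA mulrA lerD2r.
rewrite (newton_truncated_series x (ltnW kN)) ler_wpM2l ?invr_ge0 //.
apply: ler_sum => j _; rewrite /bump /= add1n subSS ler_wpM2r //.
  exact: coef_truncated_series_ge0.
by have /andP[] := xdec j.
Qed.

(** The quotient (2 n u + u^2) / (u^2 + 2 n) is at most g sqrt n, with v = sqrt n.
    As a quadratic inequality in u, its discriminant is, up to a positive factor,
    v^4 - 2 g v^3 (g v - 1) = - 2 g v^3 (v - 1), the equality being
    the equation for g. *)
Lemma quotient_step_le (R : realFieldType) (g u v : R) :
  0 < g -> g ^+ 2 = g + 2^-1 -> 1 <= v ->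
  (2 * v ^+ 2 + u) * u <= g * v * (u ^+ 2 + 2 * v ^+ 2).
Proof.
move=> g0 g2 v1.
have g1 : 1 < g.
  by rewrite ltNge; apply/negP => g1; have : g * g <= g; [nra|rewrite -expr2 g2; lra].
have h : 0 < g * v - 1 by nra.
rewrite -subr_ge0 -(pmulr_rge0 _ h).
(* Completing the square in u. *)
have -> : (g * v - 1) *
    (g * v * (u ^+ 2 + 2 * v ^+ 2) - (2 * v ^+ 2 + u) * u) =
  ((g * v - 1) * u - v ^+ 2) ^+ 2 + 2 * g * v ^+ 3 * (v - 1)
   + 2 * v ^+ 4 * (g ^+ 2 - (g + 2^-1)) by field.
rewrite g2 subrr mulr0 addr0.
have := sqr_ge0 ((g * v - 1) * u - v ^+ 2).
have : 0 <= 2 * g * v ^+ 3 * (v - 1) by rewrite !mulr_ge0 ?exprn_ge0 ?subr_ge0 //; lra.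
lra.
Qed.

(** * The terms of the series *)

(** Bounds on the power sums of a matrix of Frobenius norm 1, with u = sqrt d: the
    first one is the trace itself. *)
Definition extremal_weight (R : pzSemiRingType) (u : R) (j : nat) : R :=
  if j is 0 then u else 1.

Lemma rising_factorialS (R : realType) (a : R) k :
  rising_factorial a k.+1 = rising_factorial a k * (a + k%:R).
Proof. by rewrite /rising_factorial big_ord_recr. Qed.

Lemma rising_factorial_gt0 (R : realType) (a : R) k :
  0 < a -> 0 < rising_factorial a k.
Proof.
by move=> a0; apply: prodr_gt0 => i _; rewrite ltr_pwDl.
Qed.

(** One step of the induction for the numbers
    c_k u^k sqrt ((k+1)!) / (u^2/2)_k: the left side bounds the quotient of the
    (n+1)-st by the n-th. *)
Lemma quotient_factor_le (R : rcfType) (g u : R) n : (0 < n)%N ->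
  0 < g -> g ^+ 2 = g + 2^-1 -> 0 <= u ->
  (n%:R + u / 2) / n.+1%:R * (u / (u ^+ 2 / 2 + n%:R)) * Num.sqrt n.+2%:R <= g.
Proof.
move=> n0 g0 g2 u0; pose v : R := Num.sqrt n%:R.
have v2 : v ^+ 2 = n%:R by rewrite sqr_sqrtr.
have v1 : 1 <= v by rewrite -sqrtr1 ler_wsqrtr // ler1n.
have den0 : 0 < n.+1%:R * (u ^+ 2 + 2 * n%:R) :> R.
  by rewrite mulr_gt0 // ltr_wpDl ?sqr_ge0 // mulr_gt0 ?ltr0n.
have nR : 0 < n%:R :> R by rewrite ltr0n.
have u2 : 0 <= u ^+ 2 := sqr_ge0 u.
rewrite (_ : _ * _ =
  (2 * v ^+ 2 + u) * u * Num.sqrt n.+2%:R / (n.+1%:R * (u ^+ 2 + 2 * n%:R))); last first.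
  by rewrite v2; field; rewrite !gt_eqF //; nra.
rewrite ler_pdivrMr //.
apply: (le_trans (ler_wpM2r (sqrtr_ge0 _) (quotient_step_le u g0 g2 v1))).
have vw : v * Num.sqrt n.+2%:R <= n.+1%:R.
  rewrite -sqrtrM // -[leRHS](@ger0_norm R) // -sqrtr_sqr ler_wsqrtr //.
  by rewrite -natrM -natrX ler_nat; lia.
rewrite v2 mulrAC [leRHS]mulrA -[g * v * _]mulrA ler_wpM2r //; first by nra.
by rewrite ler_wpM2l // ltW.
Qed.

(** The induction starts at index 1, where c_1 u / (u^2 / 2) = 1. *)
Lemma truncated_series_le (R : realType) (g u : R) N k :
  0 < g -> g ^+ 2 = g + 2^-1 -> 1 <= u -> (k < N)%N ->
  (truncated_series (extremal_weight u) N)`_k.+1 * u ^+ k.+1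
    / rising_factorial (u ^+ 2 / 2) k.+1 * Num.sqrt k.+2`!%:R
  <= Num.sqrt 2 * g ^+ k.
Proof.
move=> g0 g2 u1; have u0 : 0 < u := lt_le_trans ltr01 u1.
elim: k => [|k IH] kN.
  have := newton_truncated_series (extremal_weight u) kN.
  rewrite big_ord1 /= coef0_truncated_series mul1r => ->.
  rewrite /rising_factorial big_ord1 addr0 expr0 !expr1 !mulr1.
  rewrite (_ : _ / _ = 1) ?mul1r //.
  by field; rewrite gt_eqF.
have w0 j : 0 <= extremal_weight u j by case: j => /=; rewrite ?ltW.
have wdec j : 0 <= extremal_weight u j.+1 <= extremal_weight u j.
  by rewrite w0; case: j => /=.
have := coef_truncated_series_ratio wdec kN; rewrite /= => ratio.
have {IH} := IH (ltnW kN).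
move: ratio; set c1 := _`_k.+1; set c2 := _`_k.+2 => ratio IH.
have D0 : 0 < rising_factorial (u ^+ 2 / 2) k.+1.
  by rewrite rising_factorial_gt0 // divr_gt0 ?exprn_gt0.
have E0 : 0 < u ^+ 2 / 2 + k.+1%:R by rewrite addr_gt0 ?divr_gt0 ?exprn_gt0.
rewrite rising_factorialS [k.+3`!]factS natrM sqrtrM //.
move: D0 IH; set D := rising_factorial _ _; set Q := Num.sqrt (k.+2`!)%:R => D0 IH.
set E := u ^+ 2 / 2 + _ in E0 *.
have Q0 : 0 <= Q by rewrite sqrtr_ge0.
apply: (@le_trans _ _ ((c1 * u ^+ k.+1 / D * Q) *
  ((k.+1%:R + u / 2) / k.+2%:R * (u / E) * Num.sqrt k.+3%:R))).
  rewrite (_ : _ * (_ * Q) =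
     c2 * (u ^+ k.+1 / D * Q * (u / E) * Num.sqrt k.+3%:R)); last first.
    by rewrite [u ^+ k.+2]exprS; field; rewrite !gt_eqF.
  rewrite [leRHS](_ : _ = ((k.+1%:R + u / 2) * c1 / k.+2%:R) *
     (u ^+ k.+1 / D * Q * (u / E) * Num.sqrt k.+3%:R)); last by ring.
  apply: ler_wpM2r; last by rewrite ler_pdivlMr // mulrC.
  by rewrite !mulr_ge0 ?sqrtr_ge0 ?invr_ge0 ?exprn_ge0 // ltW.
rewrite [g ^+ k.+1]exprSr [leRHS]mulrA; apply: ler_pM => //.
- by rewrite !mulr_ge0 ?invr_ge0 ?exprn_ge0 ?coef_truncated_series_ge0 // ltW.
- rewrite !mulr_ge0 ?sqrtr_ge0 ?invr_ge0 ?addr_ge0 ?mulr_ge0 ?invr_ge0 //; exact: ltW.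
by apply: quotient_factor_le => //; exact: ltW.
Qed.

Lemma bingham_termE (R : realType) d (S : 'M[R]_d) k :
  bingham_term S k = half_cycle_index (fun j => \tr (S ^+ j.+1)) k
    / rising_factorial (d%:R / 2) k.
Proof.
rewrite /bingham_term /zonal_polynomial -/(half_cycle_index (fun j => \tr (S ^+ j.+1)) k).
have a0 : rising_factorial (1 / 2) k != 0 :> R.
  by rewrite gt_eqF // rising_factorial_gt0 // divr_gt0.
have f0 : k`!%:R != 0 :> R by rewrite pnatr_eq0 -lt0n fact_gt0.
move: (_ (d%:R / 2) k)^-1 => D.
by field; rewrite a0 f0.
Qed.

Lemma norm_bingham_term_le (R : realType) (g : R) d (S : 'M[R]_d) k :
  0 < g -> g ^+ 2 = g + 2^-1 -> (0 < d)%N -> S^T = S ->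
  `|bingham_term S k.+1| <= Num.sqrt 2 / g *
     (g * frobenius_norm S / Num.sqrt d%:R) ^+ k.+1 / Num.sqrt k.+2`!%:R.
Proof.
move=> g0 g2 d0 ST; pose u : R := Num.sqrt d%:R; pose s := frobenius_norm S.
have u2 : u ^+ 2 = d%:R by rewrite sqr_sqrtr.
have u1 : 1 <= u by rewrite -sqrtr1 ler_wsqrtr // ler1n.
have u0 : 0 < u := lt_le_trans ltr01 u1.
have s0 : 0 <= s by rewrite sqrtr_ge0.
have D0 : 0 < rising_factorial (d%:R / 2 : R) k.+1.
  by rewrite rising_factorial_gt0 // divr_gt0 ?ltr0n.
have Q0 : 0 < Num.sqrt k.+2`!%:R :> R by rewrite sqrtr_gt0 ltr0n fact_gt0.
rewrite bingham_termE normrM normfV (gtr0_norm D0).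
have tr_le j : `|\tr (S ^+ j.+1)| <= s ^+ j.+1 * extremal_weight u j.
  case: j => [|j] /=; first by rewrite expr1 mulrC norm_mxtrace_le.
  by rewrite mulr1 norm_mxtrace_exp_le.
apply: (@le_trans _ _ (s ^+ k.+1 *
    (truncated_series (extremal_weight u) k.+1)`_k.+1
    / rising_factorial (d%:R / 2) k.+1)).
  rewrite ler_wpM2r ?invr_ge0 ?(ltW D0) // -half_cycle_indexE -half_cycle_index_homog.
  exact: half_cycle_index_norm_le.
have := truncated_series_le g0 g2 u1 (ltnSn k); rewrite u2.
set c := _`_k.+1; set D := rising_factorial _ _ in D0 *; set Q := Num.sqrt _`!%:R in Q0 *.
rewrite -ler_pdivlMr // => h.
rewrite [leRHS](_ : _ = (s / u) ^+ k.+1 * (Num.sqrt 2 * g ^+ k / Q)).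
  rewrite [leLHS](_ : _ = (s / u) ^+ k.+1 * (c * u ^+ k.+1 / D)).
    by rewrite ler_wpM2l // exprn_ge0 // divr_ge0 // ltW.
  by rewrite expr_div_n; field; rewrite expf_neq0 !gt_eqF.
rewrite -/s -/u !expr_div_n exprMn [g ^+ k.+1]exprS; field.
by rewrite expf_neq0 !gt_eqF.
Qed.

(** * Summing the tail *)

Lemma norm_lim_tail_le (R : realType) (a : nat -> R) m (B : R) :
  (forall l, `|a (m + l)%N| <= B * 2^-1 ^+ l) ->
  `|limn (fun n => \sum_(m <= k < n) a k)| <= 2 * B.
Proof.
move=> aB.
have B0 : 0 <= B by have := aB 0%N; rewrite mulr1; exact: le_trans.
have aB' k : (m <= k)%N -> `|a k| <= B * 2^-1 ^+ (k - m).
  by move=> mk; have := aB (k - m)%N; rewrite subnKC.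
have geo n : \sum_(i < n) B * 2^-1 ^+ i = 2 * B * (1 - 2^-1 ^+ n).
  elim: n => [|n IH]; first by rewrite big_ord0 expr0 subrr mulr0.
  by rewrite big_ord_recr /= IH exprS; field.
have bnd n : \sum_(m <= k < n) `|a k| <= 2 * B.
  rewrite -{1}(add0n m) big_addn big_mkord.
  apply: (@le_trans _ _ (\sum_(i < n - m) B * 2^-1 ^+ i)).
    by apply: ler_sum => i _; rewrite addnC.
  by rewrite geo ler_piMr ?mulr_ge0 // gerBl exprn_ge0.
have cv : cvgn (fun n => \sum_(m <= k < n) a k).
  rewrite is_cvg_series_restrict; apply: normed_cvg.
  rewrite -(is_cvg_series_restrict m).
  apply: nondecreasing_is_cvgn; last by exists (2 * B) => _ [n _ <-]; exact: bnd.
  apply/nondecreasing_seqP => n /=.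
  by have [mn|nm] := leqP m n; [rewrite big_nat_recr //= lerDl|rewrite !big_geq // ltnW].
rewrite -lim_norm //; apply: limr_le; first exact: is_cvg_norm.
by near=> n; apply: le_trans (ler_norm_sum _ _ _) _; exact: bnd.
Unshelve. all: by end_near.
Qed.

(** Each step in l multiplies the left side by q / sqrt (m+l+2), where
    q <= 1 / sqrt 2 and m+l+2 >= 2. *)
Lemma geometric_over_sqrt_fact_le (R : rcfType) (q : R) m l : (0 < m)%N ->
  0 <= q -> q ^+ 2 <= 2^-1 ->
  q ^+ (m + l) / Num.sqrt (m + l).+1`!%:R <=
    q ^+ m / Num.sqrt m.+1`!%:R * 2^-1 ^+ l.
Proof.
move=> m0 q0 q2; elim: l => [|l IH]; first by rewrite addn0 mulr1.
rewrite addnS [2^-1 ^+ _]exprSr mulrA.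
rewrite factS natrM sqrtrM ?ler0n // exprSr.
set f := Num.sqrt (_ `!)%:R in IH *; set c := Num.sqrt _.
have c0 : 0 < c by rewrite sqrtr_gt0.
have f0 : 0 < f by rewrite sqrtr_gt0 ltr0n fact_gt0.
rewrite (_ : _ / (c * f) = q ^+ (m + l) / f * (q / c)); last first.
  by field; rewrite !gt_eqF.
apply: ler_pM => //; rewrite ?divr_ge0 ?exprn_ge0 //; try exact: ltW.
rewrite ler_pdivrMr //.
have c2 : 2 <= c ^+ 2 by rewrite sqr_sqrtr // ler_nat; lia.
by rewrite -(@ler_pXn2r _ 2) ?nnegrE ?mulr_ge0 ?invr_ge0 // ?(ltW c0) // exprMn; nra.
Qed.

Lemma norm_bingham_remainder_le (R : realType) (g q : R) d (S : 'M[R]_d) m :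
  0 < g -> g ^+ 2 = g + 2^-1 -> (0 < d)%N -> S^T = S -> (0 < m)%N ->
  g * frobenius_norm S / Num.sqrt d%:R <= q -> q ^+ 2 <= 2^-1 ->
  `|bingham_remainder m S| <=
    2 * (Num.sqrt 2 / g * (q ^+ m / Num.sqrt m.+1`!%:R)).
Proof.
move=> g0 g2 d0 ST m0 xq q2; apply: norm_lim_tail_le => l.
have c0 : 0 <= Num.sqrt 2 / g by rewrite divr_ge0 ?sqrtr_ge0 // ltW.
have x0 : 0 <= g * frobenius_norm S / Num.sqrt d%:R.
  by rewrite divr_ge0 ?mulr_ge0 ?sqrtr_ge0 // ltW.
have q0 : 0 <= q := le_trans x0 xq.
rewrite -[leRHS]mulrA.
apply: le_trans (_ : _ <= Num.sqrt 2 / g * (q ^+ (m + l) / Num.sqrt (m + l).+1`!%:R)) _.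
  have -> : (m + l = (m + l).-1.+1)%N by lia.
  apply: le_trans (norm_bingham_term_le _ g0 g2 d0 ST) _.
  rewrite -mulrA; apply: ler_wpM2l => //.
  by rewrite ler_wpM2r ?invr_ge0 ?sqrtr_ge0 // lerXn2r ?nnegrE.
by rewrite ler_wpM2l // geometric_over_sqrt_fact_le.
Qed.

Lemma powR_threshold (R : realType) (a x s : R) : 0 <= a -> 0 < s ->
  a `^ (1 / s) <= x -> a <= x `^ s.
Proof.
move=> a0 s0 h; rewrite -[leLHS]powRr1 // -[X in _ `^ X](divfK (lt0r_neq0 s0)) powRrM.
by apply: (ge0_ler_powR _ _ _ h);
  rewrite ?nnegrE ?powR_ge0 ?(ltW s0) // (le_trans _ h) ?powR_ge0.
Qed.

(** * The remainder estimate *)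

Theorem proposition2p1 (R : realType) (gamma0 r : R)
    (hgamma0 : 0 < gamma0) (hr0 : 0 <= r) (hr1 : r < 1)
    (Sigma : forall d : nat, 'M[R]_d)
    (hsym : forall d : nat, (2 <= d)%N -> (Sigma d)^T = Sigma d)
    (hnorm : forall d : nat, (2 <= d)%N ->
       frobenius_norm (Sigma d) <= gamma0 * d%:R `^ (r / 2)) :
  let gamma1 : R := 1 / 2 * (1 + Num.sqrt 3) in
  let gamma2 : R := gamma0 * gamma1 in
  let gamma3 : R := 2 `^ (3 / 2) * expR (1 / 2) / gamma1 in
  (forall m d : nat, (1 <= m)%N -> (2 <= d)%N ->
     (2 * gamma2 ^+ 2) `^ (1 / (1 - r)) <= d%:R ->
     `|bingham_remainder m (Sigma d)| <=
       gamma3 * gamma2 ^+ m / Num.sqrt ((m.+1)`!%:R)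
       * d%:R `^ (- (m%:R * (1 - r) / 2))) /\
  (forall m : nat, (1 <= m)%N ->
     (fun d : nat => bingham_remainder m (Sigma d)) =O_\oo
     (fun d : nat => d%:R `^ (- (m%:R * (1 - r) / 2)))).
Proof.
move=> gamma1 gamma2 gamma3.
have s3 : Num.sqrt 3 ^+ 2 = 3 :> R by rewrite sqr_sqrtr.
have s30 : 0 <= Num.sqrt 3 :> R := sqrtr_ge0 _.
have g0 : 0 < gamma1 by rewrite /gamma1; lra.
have g2 : gamma1 ^+ 2 = gamma1 + 2^-1 by rewrite /gamma1 exprMn sqrrD s3; field.
(* From here on gamma1 enters only through its quadratic equation. *)
clearbody gamma1.
have G0 : 0 < gamma2 by rewrite mulr_gt0.
have r0 : 0 < 1 - r by rewrite subr_gt0.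
have g30 : 0 < gamma3 by rewrite divr_gt0 // mulr_gt0 ?powR_gt0 ?expR_gt0.
have bound (m d : nat) : (1 <= m)%N -> (2 <= d)%N ->
     (2 * gamma2 ^+ 2) `^ (1 / (1 - r)) <= d%:R ->
     `|bingham_remainder m (Sigma d)| <=
       gamma3 * gamma2 ^+ m / Num.sqrt ((m.+1)`!%:R)
       * d%:R `^ (- (m%:R * (1 - r) / 2)).
  move=> m1 d2 hd.
  have D0 : 0 < d%:R :> R by rewrite ltr0n; lia.
  pose p : R := d%:R `^ (- ((1 - r) / 2)).
  have p0 : 0 < p by exact: powR_gt0.
  have pm : d%:R `^ (- (m%:R * (1 - r) / 2)) = p ^+ m.
    by rewrite -powR_mulrn ?(ltW p0) // -powRrM; congr (_ `^ _); field.
  have p2 : p ^+ 2 = (d%:R `^ (1 - r))^-1.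
    by rewrite -powR_mulrn ?(ltW p0) // -powRrM -powRN; congr (_ `^ _); field.
  have hx : gamma1 * frobenius_norm (Sigma d) / Num.sqrt d%:R <= gamma2 * p.
    rewrite /gamma2 [gamma0 * _]mulrC -!mulrA ler_pM2l //.
    apply: (@le_trans _ _ (gamma0 * d%:R `^ (r / 2) / Num.sqrt d%:R)).
      by rewrite ler_wpM2r ?invr_ge0 ?sqrtr_ge0 // hnorm.
    rewrite -mulrA ler_pM2l // -powR12_sqrt ?(ltW D0) // -powRN -powRD.
      by rewrite /p (_ : r / 2 + - 2^-1 = - ((1 - r) / 2)) //; field.
    by rewrite (gt_eqF D0) implybT.
  have hq : (gamma2 * p) ^+ 2 <= 2^-1.
    have := powR_threshold (mulr_ge0 (ler0n R 2) (exprn_ge0 2 (ltW G0))) r0 hd.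
    rewrite [(gamma2 * p) ^+ 2]exprMn p2 ler_pdivrMr ?powR_gt0 //.
    by rewrite [2^-1 * _]mulrC ler_pdivlMr // mulrC.
  apply: le_trans (norm_bingham_remainder_le g0 g2 (ltnW d2) (hsym _ d2) m1 hx hq) _.
  rewrite pm [(gamma2 * p) ^+ m]exprMn.
  (* With s2, gamma3 is 2 sqrt 2 / gamma1 times expR (1 / 2). *)
  have e1 : 1 <= expR (1 / 2) :> R by rewrite -[leLHS]expR0 ler_expR; lra.
  have s2 : 2 `^ (3 / 2) = 2 * Num.sqrt 2 :> R.
    rewrite (_ : 3 / 2 = 1 + 2^-1); last by field.
    by rewrite powRD ?pnatr_eq0 ?implybT // powRr1 // powR12_sqrt.
  set f := Num.sqrt (_ `!)%:R.
  pose rest := 2 * Num.sqrt 2 / gamma1 * gamma2 ^+ m / f * p ^+ m.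
  rewrite [leLHS](_ : _ = 1 * rest); last by rewrite /rest; ring.
  rewrite [leRHS](_ : _ = expR (1 / 2) * rest); last by rewrite /rest /gamma3 s2; ring.
  apply: ler_wpM2r => //.
  by rewrite !mulr_ge0 ?invr_ge0 ?exprn_ge0 ?sqrtr_ge0 ?(ltW p0) ?(ltW G0) ?(ltW g0).
split=> // m m1; apply/eqO_exP.
exists (gamma3 * gamma2 ^+ m / Num.sqrt ((m.+1)`!%:R)).
  apply: divr_gt0; last by rewrite sqrtr_gt0 ltr0n fact_gt0.
  by apply: mulr_gt0 => //; exact: exprn_gt0.
near=> d.
rewrite [X in _ * X]ger0_norm ?powR_ge0 //.
apply: bound => //; near: d; [exact: nbhs_infty_ge | exact: nbhs_infty_ger].
Unshelve. all: by end_near.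
Qed.
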